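(* Let $H$ be a graph. Then $\#\mathrm{Hom}(H)\le\#\mathrm{Comp}(H)$.
   Context: Graphs are finite, undirected, possibly with loops; irreflexive means no loops. A homomorphism $h:V(G)\to V(H)$ maps each edge of $G$ to an edge of $H$. It uses an edge $\{w_1,w_2\}\in E(H)$ if some $\{u_1,u_2\}\in E(G)$ has $h(u_1)=w_1,h(u_2)=w_2$; a compaction is a homomorphism that uses every vertex of $H$ and every non-loop edge of $H$. $\#\mathrm{Hom}(H)$: given an irreflexive graph $G$, output the number of homomorphisms from $G$ to $H$. $\#\mathrm{Comp}(H)$: given an irreflexive graph $G$, output the number of compactions from $G$ to $H$. $P_1\le P_2$ means there is a polynomial-time Turing reduction from $P_1$ to $P_2$. *)

(* Defs.v *)
From HB Require Import structures.
From mathcomp Require Import all_boot all_order all_algebra.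
Set Implicit Arguments. Unset Strict Implicit. Unset Printing Implicit Defensive.

(** * Graphs, homomorphisms and compactions *)

Record graph := Graph {
  vertex :> finType;
  adj : rel vertex;
  adj_sym : symmetric adj }.

Arguments adj : clear implicits.

Section Homomorphisms.
Variables G H : graph.
Implicit Type h : {ffun G -> H}.

Definition is_hom h := [forall u1, forall u2, adj G u1 u2 ==> adj H (h u1) (h u2)].

Definition uses_vertex h (w : H) := [exists u, h u == w].

Definition uses_edge h (w1 w2 : H) :=
  [exists u1, exists u2, [&& adj G u1 u2, h u1 == w1 & h u2 == w2]].

Definition is_compaction h :=
  [&& is_hom h,
      [forall w, uses_vertex h w]
    & [forall w1, forall w2, (w1 != w2) && adj H w1 w2 ==> uses_edge h w1 w2]].

Definition num_hom := #|[set h | is_hom h]|.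
Definition num_compaction := #|[set h | is_compaction h]|.

End Homomorphisms.

(** * Counting problems *)

Record counting_problem := CountingProblem {
  instance : Type;
  encode : instance -> seq bool;
  answer : instance -> nat }.

Record irreflexive_graph := IrreflexiveGraph {
  graph_order : nat;
  iadj : rel 'I_graph_order;
  iadj_sym : symmetric iadj;
  iadj_irrefl : irreflexive iadj }.

Arguments iadj : clear implicits.

Coercion graph_of (G : irreflexive_graph) : graph := Graph (@iadj_sym G).

(** The order n in unary, closed by a 0, then the strict upper triangle of the
    adjacency matrix read column by column: (0,1), (0,2), (1,2), (0,3), ... *)
Definition encode_graph (G : irreflexive_graph) : seq bool :=
  nseq (graph_order G) true ++ false ::
  [seq iadj G i j | j <- enum 'I_(graph_order G),
                    i <- [seq i : 'I_(graph_order G) <-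
                            enum 'I_(graph_order G) | i < j]].

Definition count_hom (H : graph) : counting_problem :=
  CountingProblem encode_graph (fun G => num_hom G H).

Definition count_comp (H : graph) : counting_problem :=
  CountingProblem encode_graph (fun G => num_compaction G H).

(** Binary expansion, least significant bit first; [up_log 2 n.+1] is the number
    of binary digits of [n] (none for 0). *)
Definition bits_of_nat (n : nat) : seq bool :=
  mkseq (fun i => odd (n %/ 2 ^ i)) (up_log 2 n.+1).

(** * Multi-tape oracle Turing machines over {0, 1, blank} *)

(** [None] is the blank. *)
Definition cell := option bool.

(** A two-way infinite tape: [tape_right] starts at the scanned cell, [tape_left]
    lists the cells to its left, nearest first; all cells not listed are blank. *)
Record tape := Tape { tape_left : seq cell; tape_right : seq cell }.

Variant direction := MoveLeft | Stay | MoveRight.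

Definition read (t : tape) : cell := head None (tape_right t).

Definition write (c : cell) (t : tape) : tape :=
  Tape (tape_left t) (c :: behead (tape_right t)).

Definition move_head (d : direction) (t : tape) : tape :=
  match d with
  | MoveLeft => Tape (behead (tape_left t)) (head None (tape_left t) :: tape_right t)
  | Stay => t
  | MoveRight => Tape (read t :: tape_left t) (behead (tape_right t))
  end.

Definition load (w : seq bool) : tape := Tape [::] (map Some w).

Fixpoint bits_before_blank (s : seq cell) : seq bool :=
  if s is Some b :: s' then b :: bits_before_blank s' else [::].

(** The word that starts at the scanned cell. *)
Definition contents (t : tape) : seq bool := bits_before_blank (tape_right t).

Variant instruction (Q I : Type) :=
  | Halt
  | Query of Q
  | Step of ((I -> cell) -> Q * (I -> cell * direction)).

Arguments Halt {Q I}.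
Arguments Query {Q I}.
Arguments Step {Q I}.

Record oracle_machine := OracleMachine {
  state : finType;
  tape_index : finType;
  input_tape : tape_index;
  oracle_tape : tape_index;
  output_tape : tape_index;
  start : state;
  control : state -> instruction state tape_index }.

Section Semantics.
Variables (M : oracle_machine) (O : seq bool -> seq bool).

Definition configuration : Type := state M * (tape_index M -> tape).

Definition initial (w : seq bool) : configuration :=
  (start M, fun i => if i == input_tape M then load w else load [::]).

(** A query takes one step: it replaces the whole oracle tape, whose contents are
    the query, by the answer. *)
Definition step (c : configuration) : configuration :=
  let: (q, ts) := c in
  match control q with
  | Halt => c
  | Query q' =>
      (q', fun i => if i == oracle_tape M then load (O (contents (ts i))) else ts i)
  | Step delta =>
      let: (q', act) := delta (fun i => read (ts i)) in
      (q', fun i => move_head (act i).2 (write (act i).1 (ts i)))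
  end.

Definition halted (c : configuration) : bool :=
  if control c.1 is Halt then true else false.

Definition outputs_within (w : seq bool) (time : nat) (v : seq bool) : Prop :=
  exists2 t, t <= time &
    let c := iter t step (initial w) in
    halted c /\ contents (c.2 (output_tape M)) = v.

End Semantics.

(** * Polynomial-time Turing reductions *)

(** Nothing is assumed about the answers to words that encode no instance of [P]. *)
Definition oracle_for (P : counting_problem) (O : seq bool -> seq bool) : Prop :=
  forall x : instance P, O (encode x) = bits_of_nat (answer x).

Definition poly_time_Turing_reducible (P1 P2 : counting_problem) : Prop :=
  exists (M : oracle_machine) (p : {poly nat}),
  forall O : seq bool -> seq bool, oracle_for P2 O ->
  forall x : instance P1,
    outputs_within M O (encode x) p.[size (encode x)]%R (bits_of_nat (answer x)).

(* Main.v *)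
Require Import Defs.
From Stdlib Require Import FunctionalExtensionality.
From HB Require Import structures.
From mathcomp Require Import all_boot all_order all_algebra.
From mathcomp Require Import zify ring.
Set Implicit Arguments. Unset Strict Implicit. Unset Printing Implicit Defensive.
Import Order.TTheory GRing.Theory Num.Theory.

(** Inclusion-exclusion over the set A of vertices and non-loop edges of H that
    are left unused writes the number of compactions from G to H as a signed sum
    of the numbers of homomorphisms avoiding A. The latter are multiplicative in
    disjoint unions, so adding t copies of a gadget J to G turns the A-term into
    hom_A(G) * hom_A(J)^t. If every required vertex and edge is used by some
    homomorphism from J, then hom_A(J) is strictly largest at A empty, and a fixed
    integer combination of finitely many values of t yields d * hom(G) for a
    constant d > 0.

    The columns of new vertices come last in the encoding, so each query is
    written by finitely many scans of the encoding of G. Writing d = 2^a m with m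
    odd, the combination of the answers is divided by m in one simultaneous pass
    over them, least significant bit first, with a bounded carry, and the a lowest
    bits of the quotient are dropped. *)

(** * Disjoint unions *)

Lemma split_lshift m n (i : 'I_m) : split (lshift n i) = inl i.
Proof. exact: (unsplitK (inl i)). Qed.

Lemma split_rshift m n (i : 'I_n) : split (rshift m i) = inr i.
Proof. exact: (unsplitK (inr i)). Qed.

Lemma forall_ord_add m n (P : pred 'I_(m + n)) :
  [forall i, P i] = [forall i, P (lshift n i)] && [forall i, P (rshift m i)].
Proof.
apply/forallP/andP => [allP | [/forallP allPl /forallP allPr] i].
  by split; apply/forallP => i.
by case: (split_ordP i) => j ->.
Qed.

Lemma exists_ord_add m n (P : pred 'I_(m + n)) :
  [exists i, P i] = [exists i, P (lshift n i)] || [exists i, P (rshift m i)].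
Proof. by apply: negb_inj; rewrite negb_or !negb_exists forall_ord_add. Qed.

Lemma enum_ord_add m n :
  enum 'I_(m + n) = map (@lshift m n) (enum 'I_m) ++ map (@rshift m n) (enum 'I_n).
Proof.
apply: (inj_map (@ord_inj _)); rewrite [LHS]val_enum_ord map_cat iotaD.
congr (_ ++ _); rewrite -map_comp; first by rewrite -[LHS]val_enum_ord.
rewrite -[X in iota X _]addn0 iotaDl -[X in map _ X]val_enum_ord -map_comp.
exact: eq_map.
Qed.

Section DisjointUnion.
Variables G K : irreflexive_graph.
Local Notation n := (graph_order G).
Local Notation m := (graph_order K).

Definition dunion_adj : rel 'I_(n + m) := fun i j =>
  match split i, split j with
  | inl a, inl b => iadj G a b
  | inr a, inr b => iadj K a b
  | _, _ => false
  end.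

Lemma dunion_adj_sym : symmetric dunion_adj.
Proof.
move=> i j; rewrite /dunion_adj.
by case: (split i) (split j) => a [] b //; rewrite iadj_sym.
Qed.

Lemma dunion_adj_irrefl : irreflexive dunion_adj.
Proof. by move=> i; rewrite /dunion_adj; case: (split i) => a; rewrite iadj_irrefl. Qed.

Definition dunion := IrreflexiveGraph dunion_adj_sym dunion_adj_irrefl.

Lemma dunion_adj_ll a b : dunion_adj (lshift m a) (lshift m b) = iadj G a b.
Proof. by rewrite /dunion_adj !split_lshift. Qed.

Lemma dunion_adj_rr a b : dunion_adj (rshift n a) (rshift n b) = iadj K a b.
Proof. by rewrite /dunion_adj !split_rshift. Qed.

Lemma dunion_adj_lr a b : dunion_adj (lshift m a) (rshift n b) = false.
Proof. by rewrite /dunion_adj split_lshift split_rshift. Qed.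

Lemma dunion_adj_rl a b : dunion_adj (rshift n a) (lshift m b) = false.
Proof. by rewrite /dunion_adj split_lshift split_rshift. Qed.

Definition dunion_adjE := (dunion_adj_ll, dunion_adj_rr, dunion_adj_lr, dunion_adj_rl).

Variable H : graph.
Implicit Type h : {ffun dunion -> H}.

Definition restrict_l h : {ffun G -> H} := [ffun i => h (lshift m i)].
Definition restrict_r h : {ffun K -> H} := [ffun i => h (rshift n i)].

Definition glue (hG : {ffun G -> H}) (hK : {ffun K -> H}) : {ffun dunion -> H} :=
  [ffun i => match split i with inl a => hG a | inr b => hK b end].

Lemma restrict_l_glue hG hK : restrict_l (glue hG hK) = hG.
Proof. by apply/ffunP => i; rewrite !ffunE split_lshift. Qed.

Lemma restrict_r_glue hG hK : restrict_r (glue hG hK) = hK.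
Proof. by apply/ffunP => i; rewrite !ffunE split_rshift. Qed.

Lemma glue_restrict h : glue (restrict_l h) (restrict_r h) = h.
Proof. by apply/ffunP => i; rewrite ffunE; case: split_ordP => j ->; rewrite ffunE. Qed.

Lemma is_hom_dunion h : is_hom h = is_hom (restrict_l h) && is_hom (restrict_r h).
Proof.
rewrite /is_hom forall_ord_add.
congr (_ && _); apply: eq_forallb => i; rewrite forall_ord_add /=.
  rewrite [X in _ && X](_ : _ = true) ?andbT; last first.
    by apply/forallP => j; rewrite dunion_adjE.
  by apply: eq_forallb => j; rewrite dunion_adjE !ffunE.
rewrite [X in X && _](_ : _ = true); last by apply/forallP => j; rewrite dunion_adjE.
by apply: eq_forallb => j; rewrite dunion_adjE !ffunE.
Qed.

Lemma uses_vertex_dunion h w :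
  uses_vertex h w = uses_vertex (restrict_l h) w || uses_vertex (restrict_r h) w.
Proof.
by rewrite /uses_vertex exists_ord_add; congr (_ || _); apply: eq_existsb => i;
  rewrite ffunE.
Qed.

Lemma uses_edge_dunion h w1 w2 :
  uses_edge h w1 w2 = uses_edge (restrict_l h) w1 w2 || uses_edge (restrict_r h) w1 w2.
Proof.
rewrite /uses_edge exists_ord_add.
congr (_ || _); apply: eq_existsb => i; rewrite exists_ord_add /=.
  rewrite [X in _ || X](_ : _ = false) ?orbF; last first.
    by apply/existsP => -[j]; rewrite dunion_adjE.
  by apply: eq_existsb => j; rewrite dunion_adjE !ffunE.
rewrite [X in X || _](_ : _ = false); last first.
  by apply/existsP => -[j]; rewrite dunion_adjE.
by apply: eq_existsb => j; rewrite dunion_adjE !ffunE.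
Qed.

End DisjointUnion.

Definition complete_graph (n : nat) : irreflexive_graph :=
  @IrreflexiveGraph n (fun i j => i != j)
    (fun i j => congr1 negb (eq_sym i j)) (fun i => congr1 negb (eqxx i)).

Definition copies (J : irreflexive_graph) (t : nat) : irreflexive_graph :=
  iter t (dunion^~ J) (complete_graph 0).

(** * Inclusion-exclusion and interpolation *)

Section SignedSums.
Local Open Scope ring_scope.

Lemma sum_subset_sign (R : comPzRingType) (I : finType) (B : {set I}) :
  \sum_(A : {set I} | A \subset B) (-1) ^+ #|A| = (B == set0)%:R :> R.
Proof.
transitivity (\prod_(x : I) (- (x \in B)%:R + 1 : R)); last first.
  have [-> | /set0Pn[x xB]] := eqVneq B set0.
    by rewrite big1 // => x _; rewrite inE oppr0 add0r.
  by rewrite (bigD1 x) //= xB addNr mul0r.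
rewrite bigA_distr big_mkcond; apply: eq_bigr => A _; rewrite -big_mkcond /=.
case: ifPn => [/subsetP subAB | /subsetPn[x xA /negbTE xNB]].
  by rewrite (eq_bigr (fun=> -1)) ?prodr_const // => x /subAB ->.
by rewrite (bigD1 x) //= xNB oppr0 mul0r.
Qed.

Lemma inclusion_exclusion (R : comPzRingType) (T I : finType) (D : {set I})
    (P : pred T) (e : T -> pred I) :
  #|[set h | P h && [forall x in D, e h x]]|%:R =
  \sum_(A : {set I} | A \subset D)
     (-1) ^+ #|A| * #|[set h | P h && [forall x in A, ~~ e h x]]|%:R :> R.
Proof.
have card_sum (Q : pred T) : #|[set h | Q h]|%:R = \sum_h (Q h)%:R :> R.
  by rewrite -sum1dep_card natr_sum big_mkcond; apply: eq_bigr => h _; case: (Q h).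
under eq_bigr => A _ do rewrite card_sum mulr_sumr.
rewrite exchange_big card_sum; apply: eq_bigr => h _ /=.
case: (P h) => /=; last by rewrite big1 // => A _; rewrite mulr0.
pose missed := D :&: [set x | ~~ e h x].
have -> : [forall x in D, e h x] = (missed == set0).
  apply/forall_inP/eqP => [allD | missed0 x xD].
    by apply/setP => x; rewrite !inE; apply/andP => -[/allD ->].
  by have := in_set0 x; rewrite -missed0 !inE xD => /negbFE.
rewrite -sum_subset_sign [RHS]big_mkcond [LHS]big_mkcond /=.
apply: eq_bigr => A _; rewrite subsetI; case: (A \subset D) => //=.
have -> : [forall x in A, ~~ e h x] = (A \subset [set x | ~~ e h x]).
  by apply/forall_inP/subsetP => sub x /sub; rewrite inE.
by case: (A \subset _); rewrite ?mulr1 ?mulr0.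
Qed.

Lemma dominant_term_interpolation (R : numDomainType) (I : finType) (P : pred I)
    (c : I -> R) (i0 : I) :
  P i0 -> (forall i, P i -> i != i0 -> c i < c i0) ->
  exists2 L : {poly R}, 0 < L.[c i0] & forall f : I -> R,
    L.[c i0] * f i0 = \sum_(t < size L) L`_t * \sum_(i | P i) f i * c i ^+ t.
Proof.
move=> Pi0 c_lt; pose L := \prod_(i | P i && (i != i0)) ('X - (c i)%:P).
exists L => [|f].
  rewrite horner_prod; apply: prodr_gt0 => i /andP[Pi ne_i].
  by rewrite hornerXsubC subr_gt0 c_lt.
transitivity (\sum_(i | P i) f i * L.[c i]).
  rewrite (bigD1 i0) //= big1 => [|i Pi]; first by rewrite addr0 mulrC.
  by rewrite horner_prod (bigD1 i Pi) /= hornerXsubC subrr mul0r mulr0.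
under eq_bigr => i _ do rewrite horner_coef mulr_sumr.
rewrite exchange_big; apply: eq_bigr => t _ /=.
by rewrite mulr_sumr; apply: eq_bigr => i _; rewrite mulrCA.
Qed.

End SignedSums.

(** * From homomorphisms to compactions *)

Section Avoidance.
Variable H : graph.

Definition feature : finType := (H + H * H)%type.

Definition required : {set feature} :=
  [set x | if x is inr (w1, w2) then (w1 != w2) && adj H w1 w2 else true].

Definition used (G : graph) (h : {ffun G -> H}) (x : feature) : bool :=
  match x with
  | inl w => uses_vertex h w
  | inr (w1, w2) => uses_edge h w1 w2
  end.

Definition avoids (G : graph) (A : {set feature}) (h : {ffun G -> H}) : bool :=
  is_hom h && [forall x in A, ~~ used h x].

Definition num_avoiding (G : graph) (A : {set feature}) : nat :=
  #|[set h : {ffun G -> H} | avoids A h]|.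

Lemma is_compactionE (G : graph) (h : {ffun G -> H}) :
  is_compaction h = is_hom h && [forall x in required, used h x].
Proof.
rewrite /is_compaction; congr (_ && _).
apply/andP/forall_inP => [[/forallP allV /forallP allE] [w|[w1 w2]] | allU].
- by move=> _; apply: allV.
- by rewrite inE => w12; have /forallP/(_ w2)/implyP := allE w1; apply.
- split; first by apply/forallP => w; apply: (allU (inl w)); rewrite inE.
  apply/forallP => w1; apply/forallP => w2; apply/implyP => w12.
  by apply: (allU (inr (w1, w2))); rewrite inE.
Qed.

Lemma num_compaction_avoiding (G : graph) :
  ((num_compaction G H)%:R = \sum_(A : {set feature} | A \subset required)
     (-1) ^+ #|A| * (num_avoiding G A)%:R :> int)%R.
Proof.
rewrite -inclusion_exclusion /num_compaction.
by under eq_finset => h do rewrite is_compactionE.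
Qed.

Lemma num_avoiding_set0 (G : graph) : num_avoiding G set0 = num_hom G H.
Proof.
apply: eq_card => h; rewrite !inE /avoids andb_idr // => _.
by apply/forallP => x; rewrite inE.
Qed.

Lemma used_dunion (G K : irreflexive_graph) (h : {ffun dunion G K -> H}) x :
  used h x = used (restrict_l h) x || used (restrict_r h) x.
Proof.
by case: x => [w | [w1 w2]]; [apply: uses_vertex_dunion | apply: uses_edge_dunion].
Qed.

Lemma avoids_dunion (G K : irreflexive_graph) A (h : {ffun dunion G K -> H}) :
  avoids A h = avoids A (restrict_l h) && avoids A (restrict_r h).
Proof.
rewrite /avoids is_hom_dunion andbACA; congr (_ && _).
apply/forall_inP/andP => [unused | [/forall_inP unusedl /forall_inP unusedr] x xA].
  by split; apply/forall_inP => x /unused; rewrite used_dunion negb_or => /andP[].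
by rewrite used_dunion negb_or unusedl ?unusedr.
Qed.

Lemma num_avoiding_dunion (G K : irreflexive_graph) A :
  num_avoiding (dunion G K) A = num_avoiding G A * num_avoiding K A.
Proof.
pose glue_pair (p : {ffun G -> H} * {ffun K -> H}) := glue p.1 p.2.
have glue_inj : injective glue_pair.
  apply: (can_inj (g := fun h => (restrict_l h, restrict_r h))) => -[hG hK].
  by rewrite restrict_l_glue restrict_r_glue.
rewrite /num_avoiding -cardsX -(card_imset _ glue_inj); apply: eq_card => h.
rewrite inE avoids_dunion; apply/idP/imsetP => [/andP[avl avr] | [[hG hK]]].
  by exists (restrict_l h, restrict_r h); rewrite ?inE ?avl // /glue_pair glue_restrict.
by rewrite !inE => av ->; rewrite restrict_l_glue restrict_r_glue.
Qed.

Lemma num_avoiding_no_vertex A : num_avoiding (complete_graph 0) A = 1.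
Proof.
rewrite /num_avoiding (_ : [set h | _] = setT).
  by rewrite cardsT card_ffun card_ord.
apply/setP => h; rewrite !inE; apply/andP; split; first by apply/forallP => -[].
by apply/forall_inP => -[w|[w1 w2]] _; apply/existsP => -[[]].
Qed.

Lemma num_avoiding_copies J t A : num_avoiding (copies J t) A = num_avoiding J A ^ t.
Proof.
elim: t => [|t IH]; first exact: num_avoiding_no_vertex.
by rewrite /= num_avoiding_dunion IH expnSr.
Qed.

Definition detects_required (J : graph) : Prop :=
  {in required, forall x, exists2 h : {ffun J -> H}, is_hom h & used h x}.

Lemma num_avoiding_lt_hom (J : graph) (A : {set feature}) :
  detects_required J -> A \subset required -> A != set0 ->
  num_avoiding J A < num_hom J H.
Proof.
move=> detJ /subsetP reqA /set0Pn[x xA]; have [h hom_h used_h] := detJ x (reqA x xA).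
apply: proper_card; apply/properP; split.
  by apply/subsetP => g; rewrite !inE => /andP[].
exists h; rewrite !inE ?hom_h //=.
by rewrite /avoids hom_h; apply/forall_inP => /(_ x xA); rewrite used_h.
Qed.

(* The edge is left out when [H] has none, for otherwise the gadget would admit no
   homomorphism. *)
Definition gadget : irreflexive_graph :=
  if [exists w1, exists w2, adj H w1 w2]
  then dunion (complete_graph 1) (complete_graph 2) else complete_graph 1.

Lemma vertex_hom w :
  exists2 h : {ffun complete_graph 1 -> H}, is_hom h & uses_vertex h w.
Proof.
exists [ffun=> w]; last by apply/existsP; exists (ord0 : 'I_1); rewrite ffunE.
by apply/forallP => i; apply/forallP => j; rewrite /= [i]ord1 [j]ord1.
Qed.

Lemma edge_hom w1 w2 : adj H w1 w2 ->
  exists2 h : {ffun complete_graph 2 -> H}, is_hom h & uses_edge h w1 w2.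
Proof.
move=> w12; exists [ffun i : 'I_2 => if i == ord0 then w1 else w2].
  apply/forallP => i; apply/forallP => j; rewrite !ffunE; apply/implyP => /=.
  case: i j => [[|[|]]] // ilt [[|[|]]] // jlt _ //=; by rewrite adj_sym.
apply/existsP; exists (ord0 : 'I_2); apply/existsP; exists (ord_max : 'I_2).
by rewrite !ffunE /= !eqxx.
Qed.

Lemma gadget_detects_required : detects_required gadget.
Proof.
rewrite /gadget; have [/existsP[a /existsP[b ab]] | no_edge] := ifPn.
  case=> [w _ | [w1 w2]].
    have [[h1 hom1 used1] [h2 hom2 _]] := (vertex_hom w, edge_hom ab).
    exists (glue h1 h2).
      by rewrite is_hom_dunion restrict_l_glue restrict_r_glue hom1.
    by rewrite used_dunion restrict_l_glue /= used1.
  rewrite inE => /andP[_ w12].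
  have [[h1 hom1 _] [h2 hom2 used2]] := (vertex_hom a, edge_hom w12).
  exists (glue h1 h2).
    by rewrite is_hom_dunion restrict_l_glue restrict_r_glue hom1.
  by rewrite used_dunion restrict_r_glue /= used2 orbT.
case=> [w _ | [w1 w2]]; first exact: vertex_hom.
rewrite inE => /andP[_ w12]; case/negP: no_edge.
by apply/existsP; exists w1; apply/existsP; exists w2.
Qed.

Local Open Scope ring_scope.

Lemma num_hom_interpolation (J : irreflexive_graph) : detects_required J ->
  exists (L : {poly int}) (d : nat), (0 < d)%N /\
  forall G : irreflexive_graph, d%:R * (num_hom G H)%:R =
    \sum_(t < size L) L`_t * (num_compaction (dunion G (copies J t)) H)%:R :> int.
Proof.
move=> detJ; pose c (A : {set feature}) : int := (num_avoiding J A)%:R.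
have [|A reqA An0|L L_gt0 LE] :=
  @dominant_term_interpolation int _ [pred A : {set feature} | A \subset required] c set0.
- exact: sub0set.
- by rewrite /c num_avoiding_set0 ltr_nat num_avoiding_lt_hom.
exists L, `|L.[c set0]|%N; split=> [|G]; first by rewrite absz_gt0 gt_eqF.
have := LE (fun A => (-1) ^+ #|A| * (num_avoiding G A)%:R).
rewrite natz gtz0_abs // cards0 mul1r num_avoiding_set0 => ->.
apply: eq_bigr => t _; rewrite num_compaction_avoiding; congr (_ * _).
apply: eq_bigr => A _.
by rewrite num_avoiding_dunion num_avoiding_copies natrM natrX mulrA.
Qed.

End Avoidance.

(** * Encodings *)

Section Encoding.
Implicit Types G K : irreflexive_graph.

Definition column G (j : 'I_(graph_order G)) : seq bool :=
  [seq iadj G i j | i <- [seq i : 'I_(graph_order G) <- enum 'I_(graph_order G) | i < j]].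

Definition triangle G : seq bool :=
  flatten [seq column j | j <- enum 'I_(graph_order G)].

Lemma encode_graphE G : encode_graph G = nseq (graph_order G) true ++ false :: triangle G.
Proof. by []. Qed.

Lemma column_dunion_l G K (j : 'I_(graph_order G)) :
  column (lshift (graph_order K) j : 'I_(graph_order (dunion G K))) = column j.
Proof.
rewrite /column /= enum_ord_add filter_cat map_cat -[RHS]cats0; congr (_ ++ _).
  by rewrite filter_map -map_comp; apply: eq_map => i /=; apply: dunion_adj_ll.
rewrite filter_map (eq_filter (a2 := pred0)) ?filter_pred0 // => i /=.
by have := ltn_ord j; lia.
Qed.

Lemma column_dunion_r G K (j : 'I_(graph_order K)) :
  column (rshift (graph_order G) j : 'I_(graph_order (dunion G K))) =
  nseq (graph_order G) false ++ column j.
Proof.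
rewrite /column /= enum_ord_add filter_cat map_cat.
congr (_ ++ _); rewrite filter_map -map_comp.
  rewrite (all_filterP _); last by apply/allP => i _ /=; have := ltn_ord i; lia.
  rewrite -[X in nseq X _](size_enum_ord (graph_order G)).
  by elim: (enum _) => //= i s ->; rewrite dunion_adj_lr.
rewrite (eq_filter (a2 := fun i : 'I_(graph_order K) => i < j)) => [|i /=].
  by apply: eq_map => i /=; apply: dunion_adj_rr.
by rewrite ltn_add2l.
Qed.

Lemma encode_graph_dunion G K :
  encode_graph (dunion G K) =
  nseq (graph_order G) true ++ nseq (graph_order K) true ++ (false :: triangle G) ++
  flatten [seq nseq (graph_order G) false ++ column j | j <- enum 'I_(graph_order K)].
Proof.
rewrite encode_graphE /= nseqD -catA; congr (_ ++ (_ ++ _ :: _)).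
rewrite /triangle /= enum_ord_add map_cat flatten_cat -!map_comp.
congr (flatten _ ++ flatten _); apply: eq_map => j /=.
  exact: column_dunion_l.
exact: column_dunion_r.
Qed.

Lemma size_column G (j : 'I_(graph_order G)) : size (column j) = j.
Proof.
rewrite size_map -(size_map val) -(filter_map val (fun i => i < j)) [map _ _]val_enum_ord.
by rewrite (filter_iota_ltn 0) ?size_iota // ltnW.
Qed.

Lemma size_encode_graph G :
  size (encode_graph G) = (graph_order G).+1 + 'C(graph_order G, 2).
Proof.
rewrite encode_graphE size_cat size_nseq /= size_flatten /shape -map_comp addnS -addSn.
congr (_ + _); rewrite -bin2_sum big_mkord sumnE big_map big_enum.
by apply: eq_bigr => j _; apply: size_column.
Qed.

Lemma size_encode_dunion G K :
  size (encode_graph (dunion G K)) <= size (encode_graph G) * size (encode_graph K).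
Proof.
have binD2 n m : 'C(n + m, 2) = 'C(n, 2) + n * m + 'C(m, 2).
  elim: m => [|m IH]; first by rewrite addn0 muln0 !addn0.
  by rewrite addnS !binS !bin1 IH mulnS; lia.
by rewrite !size_encode_graph /= binD2; nia.
Qed.

End Encoding.

(** * Binary expansions *)

Fixpoint nat_of_bits (s : seq bool) : nat :=
  if s is b :: s' then b + (nat_of_bits s').*2 else 0.

Lemma bits_of_nat0 : bits_of_nat 0 = [::].
Proof. by rewrite /bits_of_nat up_log1. Qed.

Lemma bits_of_nat_gt0 n : 0 < n -> bits_of_nat n = odd n :: bits_of_nat n./2.
Proof.
move=> n_gt0; rewrite /bits_of_nat up_log2S // /mkseq /= divn1; congr (_ :: _).
rewrite -[1]addn0 iotaDl -map_comp; apply: eq_map => i /=.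
by rewrite add1n expnS divnMA divn2.
Qed.

Lemma bits_of_natK : cancel bits_of_nat nat_of_bits.
Proof.
elim/ltn_ind => -[|n] IH; first by rewrite bits_of_nat0.
by rewrite bits_of_nat_gt0 //= IH ?odd_double_half //; lia.
Qed.

Lemma last_bits_of_nat n : last true (bits_of_nat n).
Proof.
suff last_gt0 b : 0 < n -> last b (bits_of_nat n).
  by case: n last_gt0 => [_|n ->] //; rewrite bits_of_nat0.
elim/ltn_ind: n b => n IH b n_gt0; rewrite bits_of_nat_gt0 //=.
have [half0 | half_gt0] := posnP n./2; last by apply: IH => //; lia.
by rewrite half0 bits_of_nat0 /=; lia.
Qed.

Lemma nat_of_bitsK s : exists z, s = bits_of_nat (nat_of_bits s) ++ nseq z false.
Proof.
elim: s => [|b s [z sE]]; first by exists 0; rewrite bits_of_nat0.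
have [bs0 | bs_gt0] := posnP (nat_of_bits (b :: s)).
  exists z.+1; rewrite bs0 bits_of_nat0 /=; move: bs0 sE => /=.
  by case: b => //= /eqP; rewrite add0n double_eq0 => /eqP->; rewrite bits_of_nat0 => ->.
exists z; rewrite bits_of_nat_gt0 //= {1}sE half_bit_double.
by rewrite oddD odd_double addbF oddb.
Qed.

Lemma drop_bits_of_nat a n : drop a (bits_of_nat n) = bits_of_nat (n %/ 2 ^ a).
Proof.
elim: a n => [|a IH] n; first by rewrite drop0 divn1.
rewrite expnS divnMA divn2 -IH; case: n => [|n]; first by rewrite bits_of_nat0.
by rewrite bits_of_nat_gt0.
Qed.

Lemma size_bits_of_nat n k : n < 2 ^ k -> size (bits_of_nat n) <= k.
Proof. by move=> n_lt; rewrite size_mkseq; apply: up_log_min. Qed.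

(** * Programs for oracle machines *)

(* Equality up to trailing blanks, which the list representation of tapes keeps. *)
Definition tape_eq (t u : tape) : Prop :=
  nth None (tape_left t) =1 nth None (tape_left u) /\
  nth None (tape_right t) =1 nth None (tape_right u).

Lemma tape_eq_refl t : tape_eq t t. Proof. by []. Qed.
#[local] Hint Resolve tape_eq_refl : core.

Lemma tape_eq_sym t u : tape_eq t u -> tape_eq u t.
Proof. by case=> l_tu r_tu; split=> i; rewrite ?l_tu ?r_tu. Qed.

Lemma tape_eq_trans t u v : tape_eq t u -> tape_eq u v -> tape_eq t v.
Proof. by case=> l_tu r_tu [l_uv r_uv]; split=> i; rewrite ?l_tu ?r_tu. Qed.

Lemma tape_eq_read t u : tape_eq t u -> read t = read u.
Proof. by case=> _ r_tu; rewrite /read -!nth0. Qed.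

Lemma tape_eq_contents t u : tape_eq t u -> contents t = contents u.
Proof.
rewrite /contents => -[_]; move: (tape_right t) (tape_right u).
elim=> [|x s IH] [|y s'] eq_nth //=.
- by have /= <- := eq_nth 0.
- by have /= -> := eq_nth 0.
- have /= -> := eq_nth 0; case: y {eq_nth} (fun i => eq_nth i.+1) => [b|] //= eq_nth.
  by rewrite (IH s').
Qed.

Lemma tape_eq_move_head d t u : tape_eq t u -> tape_eq (move_head d t) (move_head d u).
Proof.
move=> eq_tu; have := tape_eq_read eq_tu; case: eq_tu => eq_l eq_r.
by case: d => //; split=> -[|i] //=; rewrite ?nth_behead -?nth0.
Qed.

Definition act (c : cell * direction) (t : tape) : tape := move_head c.2 (write c.1 t).

Lemma tape_eq_act c t u : tape_eq t u -> tape_eq (act c t) (act c u).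
Proof.
case=> eq_l eq_r; apply: tape_eq_move_head.
by split=> // -[|i] //=; rewrite !nth_behead.
Qed.

Lemma tape_eq_act_read d t : tape_eq (act (read t, d) t) (move_head d t).
Proof. by case: d t => [] [l [|x r]]; split=> // -[|[|i]] //=; rewrite ?nth_nil. Qed.

(* The word [u ++ v] with the head between [u] and [v]. *)
Definition word_tape (u v : seq bool) : tape := Tape (map Some (rev u)) (map Some v).

Lemma contents_word_tape u v : contents (word_tape u v) = v.
Proof. by rewrite /contents /=; elim: v => //= b v ->. Qed.

Lemma word_tape_catl u w v :
  word_tape (u ++ w) v = Tape (rev (map Some w) ++ map Some (rev u)) (map Some v).
Proof. by rewrite /word_tape rev_cat map_cat map_rev. Qed.

Lemma word_tape_catr u w v :
  word_tape u (w ++ v) = Tape (map Some (rev u)) (map Some w ++ map Some v).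
Proof. by rewrite /word_tape map_cat. Qed.

Definition upd (I : eqType) (T : Type) (f : I -> T) (i : I) (x : T) : I -> T :=
  [eta f with i |-> x].

Local Notation "f .[ i <- x ]" := (upd f i x)
  (at level 1, left associativity, format "f .[ i  <-  x ]").

Lemma updE (I : eqType) (T : Type) (f : I -> T) i x j :
  f.[i <- x] j = if j == i then x else f j.
Proof. by []. Qed.

Lemma iter_step_halted (M : oracle_machine) O (c : configuration M) n :
  halted c -> iter n (step O) c = c.
Proof.
move=> halt; elim: n => //= n ->.
by case: c halt => q ts; rewrite /halted /step /=; case: (control q).
Qed.

Section Programs.
Variables I S : finType.
Implicit Types (ts us : I -> tape) (s : S).

Definition tapes_eq ts us : Prop := forall i, tape_eq (ts i) (us i).

Definition reads ts (i : I) : cell := read (ts i).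

Lemma tapes_eq_reads ts us : tapes_eq ts us -> reads ts = reads us.
Proof. by move=> eq_ts; apply: functional_extensionality => i; apply: tape_eq_read. Qed.

Definition act_all (a : I -> cell * direction) ts (i : I) : tape := act (a i) (ts i).

Lemma tapes_eq_act_all a ts us : tapes_eq ts us -> tapes_eq (act_all a ts) (act_all a us).
Proof. by move=> eq_ts i; apply: tape_eq_act. Qed.

(* [Loop f] repeats the action given by [f], on the register and the scanned cells,
   until [f] returns [false], performing the last action too. *)
Variant instr :=
  | Loop of S -> (I -> cell) -> bool * S * (I -> cell * direction)
  | Ask.

Variables input oracle output : I.

Section Machine.
Variables (p : seq instr) (s0 : S).

Definition program_control (q : 'I_(size p).+1 * S) :
    instruction ('I_(size p).+1 * S)%type I :=
  match drop q.1 p with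
  | [::] => Halt
  | Loop f :: _ => Step (fun r =>
      let: (again, s, a) := f q.2 r in
      ((if again then q.1 else inord q.1.+1, s), a))
  | Ask :: _ => Query (inord q.1.+1, q.2)
  end.

Definition program_machine : oracle_machine :=
  @OracleMachine _ I input oracle output (ord0, s0) program_control.

End Machine.

Variable O : seq bool -> seq bool.

Definition answer_query ts (i : I) : tape :=
  if i == oracle then load (O (contents (ts i))) else ts i.

Lemma tapes_eq_answer_query ts us :
  tapes_eq ts us -> tapes_eq (answer_query ts) (answer_query us).
Proof.
move=> eq_ts i; rewrite /answer_query; case: eqP => // _.
by rewrite (tape_eq_contents (eq_ts i)).
Qed.

(* [exec p n s ts s' ts']: run from register s and tapes ts, the program p stops
   within n steps, with register s' and, up to trailing blanks, tapes ts'. *)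
Inductive exec : seq instr -> nat -> S -> (I -> tape) -> S -> (I -> tape) -> Prop :=
  | exec_nil n s ts ts' : tapes_eq ts ts' -> exec [::] n s ts s ts'
  | exec_exit f p n s ts s1 a s' ts' :
      f s (reads ts) = (false, s1, a) ->
      exec p n s1 (act_all a ts) s' ts' -> exec (Loop f :: p) n.+1 s ts s' ts'
  | exec_again f p n s ts s1 a s' ts' :
      f s (reads ts) = (true, s1, a) ->
      exec (Loop f :: p) n s1 (act_all a ts) s' ts' ->
      exec (Loop f :: p) n.+1 s ts s' ts'
  | exec_ask p n s ts s' ts' :
      exec p n s (answer_query ts) s' ts' -> exec (Ask :: p) n.+1 s ts s' ts'.

Lemma eq_exec p n s ts us s' ts' us' : tapes_eq us ts -> tapes_eq ts' us' ->
  exec p n s ts s' ts' -> exec p n s us s' us'.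
Proof.
move=> eq_us + ex; elim: ex us eq_us => {p n s ts s' ts'}
  [n s ts ts' eq_ts' | f p n s ts s1 a s' ts' fE _ IH | f p n s ts s1 a s' ts' fE _ IH
  | p n s ts s' ts' _ IH] us eq_us eq_us'.
- apply: exec_nil => i.
  exact: tape_eq_trans (eq_us i) (tape_eq_trans (eq_ts' i) (eq_us' i)).
- apply: exec_exit (IH _ (tapes_eq_act_all a eq_us) eq_us').
  by rewrite (tapes_eq_reads eq_us).
- apply: exec_again (IH _ (tapes_eq_act_all a eq_us) eq_us').
  by rewrite (tapes_eq_reads eq_us).
- by apply/exec_ask/IH => //; apply: tapes_eq_answer_query.
Qed.

Lemma exec_leq p n m s ts s' ts' : n <= m ->
  exec p n s ts s' ts' -> exec p m s ts s' ts'.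
Proof.
move=> le_nm ex; elim: ex m le_nm => {p n s ts s' ts'}
  [n s ts ts' eq_ts' | f p n s ts s1 a s' ts' fE _ IH | f p n s ts s1 a s' ts' fE _ IH
  | p n s ts s' ts' _ IH] [|m] // le_nm; try exact: exec_nil.
- exact: exec_exit fE (IH _ _).
- exact: exec_again fE (IH _ _).
- exact/exec_ask/IH.
Qed.

Lemma exec_cat p n s ts s1 ts1 q m s2 ts2 :
  exec p n s ts s1 ts1 -> exec q m s1 ts1 s2 ts2 ->
  exec (p ++ q) (n + m) s ts s2 ts2.
Proof.
move=> ex exq; elim: ex exq => {p n s ts s1 ts1}
  [n s ts ts' eq_ts' | f p n s ts s1 a s' ts' fE _ IH | f p n s ts s1 a s' ts' fE _ IH
  | p n s ts s' ts' _ IH] exq /=.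
- by apply: exec_leq (leq_addl n m) _; apply: eq_exec exq.
- exact: exec_exit fE (IH exq).
- exact: exec_again fE (IH exq).
- exact/exec_ask/IH.
Qed.

Lemma exec_program_machine p0 s0 p n s ts s' ts' us (pc : 'I_(size p0).+1) :
  exec p n s ts s' ts' -> drop pc p0 = p -> tapes_eq us ts ->
  let c := iter n (step (M := program_machine p0 s0) O) ((pc, s), us) in
  halted c /\ tapes_eq c.2 ts'.
Proof.
have next_pc (k : 'I_(size p0).+1) x q : drop k p0 = x :: q ->
    (inord k.+1 : 'I_(size p0).+1) = k.+1 :> nat /\ drop k.+1 p0 = q.
  move=> dropE; rewrite inordK; first by rewrite -addn1 addnC -drop_drop dropE /= drop0.
  by rewrite ltnS ltnNge; apply/negP => /drop_oversize; rewrite dropE.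
move=> ex; elim: ex us pc => {p n s ts s' ts'}
  [n s ts ts' eq_ts' | f p n s ts s1 a s' ts' fE _ IH | f p n s ts s1 a s' ts' fE _ IH
  | p n s ts s' ts' _ IH] us pc dropE eq_us.
- have halt : halted (M := program_machine p0 s0) ((pc, s), us).
    by rewrite /halted /= /program_control /= dropE.
  rewrite iter_step_halted //; split=> // i.
  exact: tape_eq_trans (eq_us i) (eq_ts' i).
- rewrite iterSr [step _ _](_ : _ = ((inord pc.+1, s1), act_all a us)).
    have [pcE dropE'] := next_pc _ _ _ dropE.
    by apply: IH; [rewrite pcE | apply: tapes_eq_act_all].
  by rewrite /step /= /program_control /= dropE /= -/(reads us) (tapes_eq_reads eq_us) fE.
- rewrite iterSr [step _ _](_ : _ = ((pc, s1), act_all a us)).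
    by apply: IH; last exact: tapes_eq_act_all.
  by rewrite /step /= /program_control /= dropE /= -/(reads us) (tapes_eq_reads eq_us) fE.
- rewrite iterSr [step _ _](_ : _ = ((inord pc.+1, s), answer_query us)).
    have [pcE dropE'] := next_pc _ _ _ dropE.
    by apply: IH; [rewrite pcE | apply: tapes_eq_answer_query].
  by rewrite /step /= /program_control /= dropE.
Qed.

Lemma exec_outputs_within p s0 w n v s' ts' :
  exec p n s0 (fun i => if i == input then load w else load [::]) s' ts' ->
  contents (ts' output) = v -> outputs_within (program_machine p s0) O w n v.
Proof.
move=> ex <-; exists n => //.
have [halts eq_ts'] :=
  exec_program_machine s0 (pc := ord0) ex (drop0 p) (fun=> tape_eq_refl _).
by split=> //; apply: tape_eq_contents.
Qed.

(* One uniform bound [L] on the executions of each instruction makes the running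
   time of a program a multiple of its size, so that no cost needs to be tracked. *)
Variable L : nat.

Definition runs p s ts s' ts' : Prop := exec p (size p * L) s ts s' ts'.

Lemma eq_runs p s ts us s' ts' us' : tapes_eq us ts -> tapes_eq ts' us' ->
  runs p s ts s' ts' -> runs p s us s' us'.
Proof. exact: eq_exec. Qed.

Lemma runs_nil s ts ts' : tapes_eq ts ts' -> runs [::] s ts s ts'.
Proof. exact: exec_nil. Qed.

Lemma runs_cat p q s ts s1 ts1 s2 ts2 :
  runs p s ts s1 ts1 -> runs q s1 ts1 s2 ts2 -> runs (p ++ q) s ts s2 ts2.
Proof. by rewrite /runs size_cat mulnDl; apply: exec_cat. Qed.

Lemma runs1 x n s ts s' ts' :
  n <= L -> exec [:: x] n s ts s' ts' -> runs [:: x] s ts s' ts'.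
Proof. by rewrite /runs mul1n; apply: exec_leq. Qed.

Lemma runs_ask s ts : 0 < L -> runs [:: Ask] s ts s (answer_query ts).
Proof. by move=> L_gt0; apply: (@runs1 _ 1) => //; apply/exec_ask/exec_nil. Qed.

Definition keep (r : I -> cell) (i : I) : cell * direction := (r i, Stay).

Lemma act_all_keep ts : tapes_eq (act_all (keep (reads ts)) ts) ts.
Proof. by move=> i; apply: tape_eq_act_read. Qed.

End Programs.
Arguments Ask {I S}.
Arguments reads : simpl never.

(** * Programs on words *)

Section WordPrograms.
Variables I S : finType.
Variables (oracle : I) (O : seq bool -> seq bool) (L : nat).
Local Notation instr := (instr I S).
Local Notation exec := (@exec I S oracle O).
Local Notation runs := (@runs I S oracle O L).
Implicit Types (i j : I) (s : S) (r : I -> cell) (ts : I -> tape).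
Implicit Types (P : pred cell) (e g : cell -> cell) (u v w x : seq bool) (b : bool).

Definition once (a : (I -> cell) -> I -> cell * direction) : instr :=
  Loop (fun s r => (false, s, a r)).

Lemma runs_once a s ts : 0 < L -> runs [:: once a] s ts s (act_all (a (reads ts)) ts).
Proof. by move=> L_gt0; apply: runs1 L_gt0 _; apply: exec_exit => //; apply: exec_nil. Qed.

Definition scan_right P e g i j : instr := Loop (fun s r =>
  if P (r i)
  then (true, s, (keep r).[i <- (e (r i), MoveRight)].[j <- (g (r i), MoveRight)])
  else (false, s, keep r)).

Lemma exec_scan_right P e g i j s ts (w l r l' : seq cell) :
  i != j -> all P w -> ~~ P (head None r) ->
  tape_eq (ts i) (Tape l (w ++ r)) -> tape_eq (ts j) (Tape l' [::]) ->
  exec [:: scan_right P e g i j] (size w).+1 s ts s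
    ts.[i <- Tape (rev (map e w) ++ l) r].[j <- Tape (rev (map g w) ++ l') [::]].
Proof.
move=> ne_ij + stop; elim: w l l' ts => [|c w IH] l l' ts /=.
  move=> _ ts_i ts_j; apply: exec_exit.
    by rewrite /reads (tape_eq_read ts_i) (negbTE stop).
  apply: exec_nil => k; apply: tape_eq_trans (act_all_keep _ _) _.
  by rewrite /upd /=; case: eqP => [->|_] //; case: eqP => [->|_].
case/andP=> Pc Pw ts_i ts_j.
have read_i : reads ts i = c by rewrite /reads (tape_eq_read ts_i).
apply: exec_again; first by rewrite read_i Pc.
apply: eq_exec (IH (e c :: l) (g c :: l') _ Pw _ _) => [//|k||]; rewrite /act_all /upd /=.
- rewrite !rev_cons !cat_rcons; case: eqP => // _; case: eqP => // _.
  exact: tape_eq_act_read.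
- by rewrite eqxx (negbTE ne_ij); apply: tape_eq_act (e c, MoveRight) _ _ ts_i.
- by rewrite eqxx; apply: tape_eq_act (g c, MoveRight) _ _ ts_j.
Qed.

Definition scan_left P e i : instr := Loop (fun s r =>
  if P (r i) then (true, s, (keep r).[i <- (e (r i), MoveLeft)])
  else (false, s, (keep r).[i <- (r i, MoveRight)])).

Lemma exec_scan_left P e i s ts (w l r : seq cell) :
  all P w -> ~~ P (head None l) ->
  tape_eq (ts i) (Tape (behead (w ++ l)) (head None (w ++ l) :: r)) ->
  exec [:: scan_left P e i] (size w).+1 s ts s ts.[i <- Tape l (rev (map e w) ++ r)].
Proof.
move=> + stop; elim: w r ts => [|c w IH] r ts /=.
  move=> _ ts_i.
  have read_i : reads ts i = head None l by rewrite /reads (tape_eq_read ts_i).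
  apply: exec_exit; first by rewrite read_i (negbTE stop).
  apply: exec_nil => k; rewrite /act_all /upd /=; case: eqP => [->|_].
    apply: tape_eq_trans (tape_eq_act _ ts_i) _.
    by rewrite /act /=; split=> // -[|i'] //=; rewrite ?nth0 ?nth_behead.
  exact: tape_eq_act_read.
case/andP=> Pc Pw ts_i.
have read_i : reads ts i = c by rewrite /reads (tape_eq_read ts_i).
apply: exec_again; first by rewrite read_i Pc.
apply: eq_exec (IH (e c :: r) _ Pw _) => [//|k|]; rewrite /act_all /upd /=.
- rewrite rev_cons cat_rcons; case: eqP => // _; exact: tape_eq_act_read.
- by rewrite eqxx; apply: tape_eq_act (e c, MoveLeft) _ _ ts_i.
Qed.

Definition step_left i : instr := once (fun r => (keep r).[i <- (r i, MoveLeft)]).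

Definition scan_back P e i : seq instr := [:: step_left i; scan_left P e i].

Lemma exec_scan_back P e i s ts (w l r : seq cell) :
  all P w -> ~~ P (head None l) -> tape_eq (ts i) (Tape (w ++ l) r) ->
  exec (scan_back P e i) (size w).+2 s ts s
    ts.[i <- Tape l (rev (map e w) ++ r)].
Proof.
move=> Pw stop ts_i; apply: (exec_exit (erefl _)).
apply: eq_exec (exec_scan_left _ _ Pw stop _) => [//|k|]; rewrite /act_all /upd /=.
  by case: eqP => // _; apply: tape_eq_act_read.
rewrite eqxx; apply: tape_eq_trans (tape_eq_act_read _ _) _.
exact: (tape_eq_move_head MoveLeft ts_i).
Qed.

Definition pad b i j : instr := scan_right (pred1 (Some true)) id (fun=> Some b) i j.

Lemma runs_pad b n i j s ts u v x :
  i != j -> n < L -> ~~ head false v ->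
  tape_eq (ts i) (word_tape u (nseq n true ++ v)) -> tape_eq (ts j) (word_tape x [::]) ->
  runs [:: pad b i j] s ts s
    ts.[i <- word_tape (u ++ nseq n true) v].[j <- word_tape (x ++ nseq n b) [::]].
Proof.
move=> ne_ij lt_nL stop; rewrite word_tape_catr !word_tape_catl !map_nseq => ts_i ts_j.
have := exec_scan_right (P := pred1 (Some true)) id (fun=> Some b) s ne_ij _ _ ts_i ts_j.
rewrite !map_nseq size_nseq => ex; apply: runs1 lt_nL (ex _ _).
  exact: all_pred1_nseq.
by case: v stop {ts_i ex} => //= -[].
Qed.

Definition copy i j : instr := scan_right isSome id id i j.

Lemma runs_copy i j s ts u w x :
  i != j -> size w < L ->
  tape_eq (ts i) (word_tape u w) -> tape_eq (ts j) (word_tape x [::]) ->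
  runs [:: copy i j] s ts s
    ts.[i <- word_tape (u ++ w) [::]].[j <- word_tape (x ++ w) [::]].
Proof.
move=> ne_ij lt_wL; rewrite -{1}[w]cats0 word_tape_catr !word_tape_catl => ts_i ts_j.
have := exec_scan_right (P := isSome) id id s ne_ij _ _ ts_i ts_j.
rewrite !map_id size_map => ex; apply: runs1 lt_wL (ex _ _) => //.
by rewrite all_map; apply/allP.
Qed.

Lemma nth_erased (T : Type) (w : seq T) :
  nth None [seq None | _ <- w] =1 nth (None : cell) [::].
Proof. by move=> k; rewrite nth_nil; elim: w k => [|c w IH] [|k] /=. Qed.

Definition transfer i j : instr := scan_right isSome (fun=> None) id i j.

Lemma runs_transfer i j s ts w x :
  i != j -> size w < L ->
  tape_eq (ts i) (word_tape [::] w) -> tape_eq (ts j) (word_tape x [::]) ->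
  runs [:: transfer i j] s ts s
    ts.[i <- word_tape [::] [::]].[j <- word_tape (x ++ w) [::]].
Proof.
move=> ne_ij lt_wL; rewrite -{1}[w]cats0 word_tape_catr word_tape_catl => ts_i ts_j.
have := exec_scan_right (P := isSome) (fun=> None) id s ne_ij _ _ ts_i ts_j.
rewrite map_id size_map => ex; apply: eq_exec (runs1 lt_wL (ex _ _)) => // [k|].
  rewrite /upd /=; case: eqP => // _; case: eqP => // _.
  by split=> // k'; rewrite /= cats0 -map_rev nth_erased.
by rewrite all_map; apply/allP.
Qed.

Definition rewind i : seq instr := scan_back isSome id i.

Lemma runs_rewind i s ts u v :
  size u < L -> tape_eq (ts i) (word_tape u v) ->
  runs (rewind i) s ts s ts.[i <- word_tape [::] (u ++ v)].
Proof.
move=> lt_uL; rewrite /word_tape -[map Some (rev u)]cats0 => ts_i.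
have := exec_scan_back (P := isSome) id s _ _ ts_i.
rewrite map_id -map_rev revK -map_cat size_map size_rev => ex.
apply: exec_leq (ex _ _) => //=; first by lia.
by rewrite all_map; apply/allP.
Qed.

Definition trim i : seq instr := scan_back (pred1 (Some false)) (fun=> None) i.

Lemma runs_trim z i s ts u :
  z < L -> last true u -> tape_eq (ts i) (word_tape (u ++ nseq z false) [::]) ->
  runs (trim i) s ts s ts.[i <- word_tape u [::]].
Proof.
move=> lt_zL last_u; rewrite word_tape_catl map_nseq rev_nseq => ts_i.
have := exec_scan_back (P := pred1 (Some false)) (fun=> None) s _ _ ts_i.
rewrite size_nseq => ex; apply: exec_leq (_ : z.+2 <= _) _; first by rewrite /=; lia.
apply: eq_exec (ex _ _) => // [k||].
- rewrite /upd /=; case: eqP => // _.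
  by split=> // k'; rewrite /= cats0 -map_rev nth_erased.
- exact: all_pred1_nseq.
- by case/lastP: u last_u {ts_i ex} => // u c; rewrite last_rcons rev_rcons => ->.
Qed.

Definition emit j w : seq instr :=
  [seq once (fun r => (keep r).[j <- (Some b, MoveRight)]) | b <- w].

Lemma runs_emit j w s ts x : 0 < L -> tape_eq (ts j) (word_tape x [::]) ->
  runs (emit j w) s ts s ts.[j <- word_tape (x ++ w) [::]].
Proof.
move=> L_gt0; elim: w x ts => [|b w IH] x ts ts_j.
  apply: runs_nil => k; rewrite updE; case: eqP => // ->.
  by rewrite cats0.
rewrite [emit _ _]/= -cat1s; apply: runs_cat (runs_once _ _ _ L_gt0) _.
rewrite -cat_rcons; apply: eq_exec (IH (rcons x b) _ _) => [//|k|].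
  rewrite /act_all !updE; case: eqP => // _; exact: tape_eq_act_read.
rewrite /act_all updE eqxx /word_tape rev_rcons.
exact: tape_eq_act (Some b, MoveRight) _ _ ts_j.
Qed.

Definition skip j : instr := once (fun r =>
  if r j is Some b then (keep r).[j <- (Some b, MoveRight)] else keep r).

Lemma runs_skip a j s ts u v : 0 < L -> tape_eq (ts j) (word_tape u v) ->
  runs (nseq a (skip j)) s ts s ts.[j <- word_tape (u ++ take a v) (drop a v)].
Proof.
move=> L_gt0; elim: a u v ts => [|a IH] u v ts ts_j.
  apply: runs_nil => k; rewrite updE; case: eqP => // ->.
  by rewrite take0 drop0 cats0.
rewrite [nseq _ _]/= -cat1s; apply: runs_cat (runs_once _ _ _ L_gt0) _.
have read_j : reads ts j = head None (map Some v) by rewrite /reads (tape_eq_read ts_j).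
case: v ts_j read_j => [|b v] ts_j /= ->.
  apply: eq_exec (IH u [::] _ _) => [//|k|]; last first.
    exact: tape_eq_trans (act_all_keep _ _) _.
  by rewrite !updE; case: eqP => // _; apply: act_all_keep.
rewrite -cat_rcons; apply: eq_exec (IH (rcons u b) v _ _) => [//|k|].
  rewrite /act_all !updE; case: eqP => // _; exact: tape_eq_act_read.
rewrite /act_all updE eqxx /word_tape rev_rcons.
exact: tape_eq_act (Some b, MoveRight) _ _ ts_j.
Qed.

Definition drop_low_bits a j : seq instr := trim j ++ rewind j ++ nseq a (skip j).

Lemma runs_drop_low_bits a j s ts w : size w < L -> tape_eq (ts j) (word_tape w [::]) ->
  exists u, runs (drop_low_bits a j) s ts s
    ts.[j <- word_tape u (bits_of_nat (nat_of_bits w %/ 2 ^ a))].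
Proof.
move=> lt_wL ts_j; have [z wE] := nat_of_bitsK w.
set v := bits_of_nat (nat_of_bits w) in wE.
have size_wE : size w = size v + z by rewrite wE size_cat size_nseq.
rewrite wE in ts_j; exists (take a v); rewrite -drop_bits_of_nat -/v.
apply: runs_cat (runs_trim _ _ (last_bits_of_nat _) ts_j) _; first by lia.
apply: runs_cat (runs_rewind (u := v) (v := [::]) _ _ _) _; first by lia.
  by rewrite updE eqxx.
apply: eq_runs (runs_skip a (u := [::]) (v := v) _ _ _) => [//|k||]; first last.
- by rewrite !updE eqxx cats0.
- by lia.
- by rewrite !updE; case: eqP.
Qed.

Definition write_column i j w : seq instr := pad false i j :: emit j w ++ rewind i.

Lemma runs_write_columns i j ws n s ts v x :
  i != j -> n < L -> tape_eq (ts i) (word_tape [::] (nseq n true ++ false :: v)) ->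
  tape_eq (ts j) (word_tape x [::]) ->
  runs (flatten [seq write_column i j w | w <- ws]) s ts s
    ts.[j <- word_tape (x ++ flatten [seq nseq n false ++ w | w <- ws]) [::]].
Proof.
move=> ne_ij lt_nL ts_i; elim: ws x ts ts_i => [|w ws IH] x ts ts_i ts_j.
  by apply: runs_nil => k; rewrite updE; case: eqP => // ->; rewrite cats0.
rewrite [flatten _]/= [flatten [seq _ ++ _ | w <- _ :: _]]/= -cat1s -!catA.
apply: runs_cat.
  by apply: (runs_pad _ _ _ _ _ ts_i ts_j).
apply: runs_cat.
  apply: (runs_emit _ _ (x := x ++ nseq n false)); first by lia.
  by rewrite updE eqxx.
apply: runs_cat.
  apply: (runs_rewind _ (u := nseq n true) (v := false :: v)); first by rewrite size_nseq.
  by rewrite !updE eqxx (negbTE ne_ij).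
apply: eq_runs (IH ((x ++ nseq n false) ++ w) _ _ _) => [//|k||].
- by rewrite !updE !catA; case: eqP => // _; case: eqP => [->|_] //; apply: tape_eq_sym.
- by rewrite updE eqxx.
- by rewrite !updE eqxx eq_sym (negbTE ne_ij).
Qed.

Definition write_dunion K i j : seq instr :=
  pad true i j :: emit j (nseq (graph_order K) true) ++ copy i j :: rewind i ++
  flatten [seq write_column i j (column k) | k <- enum 'I_(graph_order K)] ++ rewind j.

Lemma runs_write_dunion (G K : irreflexive_graph) i j s ts :
  i != j -> size (encode_graph G) < L -> size (encode_graph (dunion G K)) < L ->
  tape_eq (ts i) (word_tape [::] (encode_graph G)) ->
  tape_eq (ts j) (word_tape [::] [::]) ->
  runs (write_dunion K i j) s ts s ts.[j <- word_tape [::] (encode_graph (dunion G K))].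
Proof.
move=> ne_ij lt_GL lt_dunionL; set n := graph_order G; set m := graph_order K.
have lt_nL : n < L.
  by apply: leq_ltn_trans lt_GL; rewrite size_encode_graph -/n addSnnS leq_addr.
have L_gt0 : 0 < L by lia.
have lt_triL : (size (triangle G)).+1 < L.
  by apply: leq_ltn_trans lt_GL; rewrite encode_graphE size_cat leq_addl.
pose prefix := (nseq n true ++ nseq m true) ++ false :: triangle G.
have dunionE : encode_graph (dunion G K) =
    prefix ++ flatten [seq nseq n false ++ w | w <- [seq column k | k <- enum 'I_m]].
  by rewrite encode_graph_dunion -map_comp -!catA.
rewrite encode_graphE -/n => ts_i ts_j.
rewrite /write_dunion -cat1s; apply: runs_cat.
  by apply: (runs_pad _ _ _ _ _ ts_i ts_j).
apply: runs_cat.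
  by apply: (runs_emit _ _ (x := nseq n true)); rewrite // updE eqxx.
rewrite -cat1s; apply: runs_cat.
  apply: (runs_copy _ (u := nseq n true) (w := false :: triangle G)
            (x := nseq n true ++ nseq m true)) => //.
    by rewrite !updE eqxx (negbTE ne_ij).
  by rewrite !updE eqxx.
apply: runs_cat.
  apply: (runs_rewind _ (u := encode_graph G) (v := [::])) => //.
  by rewrite !updE eqxx (negbTE ne_ij) encode_graphE.
rewrite (map_comp (write_column i j)); apply: runs_cat.
  apply: (runs_write_columns _ _ (v := triangle G) (x := prefix) ne_ij lt_nL).
    by rewrite !updE eqxx cats0.
  by rewrite !updE eqxx eq_sym (negbTE ne_ij).
rewrite -dunionE.
apply: eq_runs (runs_rewind _ (u := encode_graph (dunion G K)) (v := [::]) _ _)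
  => [//|k|//|].
  by rewrite !updE !cats0; case: eqP => // _; case: eqP => [->|_] //; apply: tape_eq_sym.
by rewrite updE eqxx.
Qed.

Definition query_dunion K i k : seq instr :=
  write_dunion K i oracle ++ [:: Ask] ++ [:: transfer oracle k] ++ rewind k.

Lemma runs_query_dunion (G K : irreflexive_graph) i k s ts :
  i != oracle -> oracle != k ->
  size (encode_graph G) < L -> size (encode_graph (dunion G K)) < L ->
  size (O (encode_graph (dunion G K))) < L ->
  tape_eq (ts i) (word_tape [::] (encode_graph G)) ->
  tape_eq (ts oracle) (word_tape [::] [::]) -> tape_eq (ts k) (word_tape [::] [::]) ->
  runs (query_dunion K i k) s ts s
    ts.[k <- word_tape [::] (O (encode_graph (dunion G K)))].
Proof.
move=> ne_io ne_ok lt_GL lt_dunionL; set w := O _ => lt_wL ts_i ts_o ts_k.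
apply: runs_cat; first exact: runs_write_dunion ts_i ts_o.
apply: runs_cat; first by apply: runs_ask; lia.
apply: runs_cat.
  apply: (runs_transfer _ (w := w) (x := [::]) ne_ok lt_wL).
    by rewrite /answer_query updE eqxx contents_word_tape.
  by rewrite /answer_query updE eq_sym (negbTE ne_ok).
apply: eq_runs (runs_rewind _ (u := w) (v := [::]) _ _) => [//|l|//|].
  rewrite cats0 !updE; case: eqP => // _; case: eqP => [->|ne_lo].
    exact: tape_eq_sym.
  by rewrite /answer_query updE; case: eqP ne_lo.
by rewrite updE eqxx.
Qed.

Definition query_dunions (T : Type) (K : T -> irreflexive_graph) i (ans : T -> I)
    (r : seq T) : seq instr :=
  flatten [seq query_dunion (K t) i (ans t) | t <- r].

Lemma runs_query_dunions (T : eqType) (K : T -> irreflexive_graph) (ans : T -> I)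
    (r : seq T) (G : irreflexive_graph) i s ts :
  i != oracle -> (forall t, ans t != oracle) -> (forall t, ans t != i) ->
  injective ans -> uniq r ->
  size (encode_graph G) < L ->
  (forall t, size (encode_graph (dunion G (K t))) < L) ->
  (forall t, size (O (encode_graph (dunion G (K t)))) < L) ->
  tape_eq (ts i) (word_tape [::] (encode_graph G)) ->
  tape_eq (ts oracle) (word_tape [::] [::]) ->
  {in r, forall t, tape_eq (ts (ans t)) (word_tape [::] [::])} ->
  exists ts', [/\ runs (query_dunions K i ans r) s ts s ts',
    {in r, forall t, ts' (ans t) = word_tape [::] (O (encode_graph (dunion G (K t))))}
    & forall j, j \notin map ans r -> ts' j = ts j].
Proof.
move=> ne_io ne_ao ne_ai ans_inj + lt_GL lt_dunionL lt_ansL.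
elim: r ts => [|t r IH] ts /=; first by exists ts; split=> //; apply: runs_nil.
case/andP=> t_r uniq_r ts_i ts_o ts_ans.
pose w := O (encode_graph (dunion G (K t))).
have [||t' t'_r|ts' [ex ts'_ans ts'_other]] := IH ts.[ans t <- word_tape [::] w] uniq_r.
- by rewrite updE eq_sym (negbTE (ne_ai t)).
- by rewrite updE eq_sym (negbTE (ne_ao t)).
- rewrite updE (inj_eq ans_inj); case: eqP t'_r t_r => [-> -> //|_ t'_r _].
  by apply: ts_ans; rewrite inE t'_r orbT.
exists ts'; split=> [|t'|j].
- apply: runs_cat ex; apply: runs_query_dunion => //; first by rewrite eq_sym.
  by apply: ts_ans; rewrite mem_head.
- rewrite inE => /predU1P[->|]; last exact: ts'_ans.
  by rewrite ts'_other ?mem_map // updE eqxx.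
- by rewrite inE negb_or => /andP[ne_j /ts'_other->]; rewrite updE (negbTE ne_j).
Qed.

End WordPrograms.
Arguments query_dunions {I S} oracle {T}.
Arguments drop_low_bits {I S}.

(** * Serial division *)

Section SerialDivision.
Local Open Scope ring_scope.
Variables (T : finType) (l : T -> int) (m : nat).
Hypothesis odd_m : odd m.
Implicit Types (c v : int) (A : T -> seq bool) (X n : nat).

Definition carry_bound : nat := (\sum_t `|l t| + m)%N.
Definition carry : finType := 'I_(carry_bound.*2.+1).
Definition int_of_carry (s : carry) : int := (s : nat)%:Z - carry_bound%:Z.
Definition carry_of_int c : carry := inord `|c + carry_bound%:Z|.

Lemma carry_of_intK c : `|c| <= carry_bound%:Z -> int_of_carry (carry_of_int c) = c.
Proof. by move=> c_small; rewrite /int_of_carry inordK; lia. Qed.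

Definition pending c A : int := c + \sum_t l t * (nat_of_bits (A t))%:R.

Lemma pending_nil c A : (forall t, nilp (A t)) -> pending c A = c.
Proof.
by move=> A0; rewrite /pending big1 ?addr0 // => t _; rewrite (nilP (A0 t)) mulr0.
Qed.

Definition digit_sum c (b : T -> bool) : int := c + \sum_t l t * (b t)%:R.

(* Since [m] is odd, the next quotient bit is the parity of [v]. *)
Definition next_carry v : int := ((v - (m * odd `|v|)%:Z) %/ 2)%Z.

Lemma next_carryE v : v = 2 * next_carry v + (m * odd `|v|)%:Z.
Proof.
have even_diff : (2 %| v - (m * odd `|v|)%:Z)%Z.
  by move: odd_m; case: (boolP (odd `|v|)); rewrite ?muln1 ?muln0; lia.
by rewrite mulrC divzK // subrK.
Qed.

Lemma norm_next_carry c b : `|c| <= carry_bound%:Z ->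
  `|next_carry (digit_sum c b)| <= carry_bound%:Z.
Proof.
move=> c_small; have sum_small : `|\sum_t l t * (b t)%:R| <= (\sum_t `|l t|)%N%:Z.
  apply: le_trans (ler_norm_sum _ _ _) _; rewrite (big_morph Posz PoszD (erefl _)).
  by apply: ler_sum => t _; case: (b t); rewrite ?mulr1 ?mulr0 ?normr0 // abszE.
have := next_carryE (digit_sum c b); move: c_small sum_small.
rewrite /carry_bound [X in X = _]/digit_sum; set z := next_carry _.
move: (\sum_t l t * _) (\sum_t _)%N => x y.
by case: (odd _); rewrite ?muln1 ?muln0; lia.
Qed.

Section QuotientStep.
Variables (c : int) (A : T -> seq bool) (X : nat).
Hypothesis pendingE : pending c A = (m * X)%N.
Let v := digit_sum c (head false \o A).

Lemma pending_digit_sum :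
  pending c A = v + 2 * \sum_t l t * (nat_of_bits (behead (A t)))%:R.
Proof.
rewrite /pending /v /digit_sum -addrA mulr_sumr -big_split /=; congr (_ + _).
apply: eq_bigr => t _; case: (A t) => [|b w] /=; first by ring.
by rewrite -muln2 natrD natrM; ring.
Qed.

Lemma odd_digit_sum : odd `|v| = odd X.
Proof.
have : odd `|v| = odd (m * X).
  by move: pendingE; rewrite pending_digit_sum; set y := \sum_t _; lia.
by rewrite oddM odd_m.
Qed.

Lemma pending_next_carry : pending (next_carry v) (behead \o A) = (m * X./2)%N.
Proof.
have := next_carryE v; rewrite odd_digit_sum; move: pendingE.
rewrite pending_digit_sum /pending /=; set y := \sum_t _; set z := next_carry v.
by rewrite -[in (m * X)%N](odd_double_half X) mulnDr; case: (odd X); nia.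
Qed.

End QuotientStep.

Variables (I : finType) (ans : T -> I) (out : I).
Hypothesis ans_neq_out : forall t, ans t != out.

Definition divide : instr I carry := Loop (fun s r =>
  if (int_of_carry s == 0) && [forall t, r (ans t) == None] then (false, s, keep r)
  else let v := digit_sum (int_of_carry s) (fun t => r (ans t) == Some true) in
    (true, carry_of_int (next_carry v),
     (fun i => (r i, MoveRight)).[out <- (Some (odd `|v|), MoveRight)])).

Variables (oracle : I) (O : seq bool -> seq bool).

Lemma exec_divide_stop ts : (forall t, reads ts (ans t) = None) ->
  exec oracle O [:: divide] 1 (carry_of_int 0) ts (carry_of_int 0) ts.
Proof.
move=> blank; apply: exec_exit; last by apply: exec_nil; apply: act_all_keep.
by rewrite carry_of_intK // eqxx ifT //; apply/forallP => t; rewrite blank.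
Qed.

Lemma exec_divide_again n c b ts s' ts' :
  let v := digit_sum c b in
  `|c| <= carry_bound%:Z -> ~~ ((c == 0) && [forall t, reads ts (ans t) == None]) ->
  (forall t, (reads ts (ans t) == Some true) = b t) ->
  exec oracle O [:: divide] n (carry_of_int (next_carry v))
    (act_all (fun i => (reads ts i, MoveRight)).[out <- (Some (odd `|v|), MoveRight)] ts)
    s' ts' ->
  exec oracle O [:: divide] n.+1 (carry_of_int c) ts s' ts'.
Proof.
move=> v c_small go bE; apply: exec_again.
rewrite carry_of_intK // ifN //.
suff -> : digit_sum c (fun t => reads ts (ans t) == Some true) = v by [].
by congr (_ + _); apply: eq_bigr => t _; rewrite bE.
Qed.

Lemma exec_divide n c A X ts y x :
  `|c| <= carry_bound%:Z -> (forall t, size (A t) <= n)%N -> (X < 2 ^ n)%N ->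
  pending c A = (m * X)%N ->
  (forall t, tape_eq (ts (ans t)) (Tape (y t) (map Some (A t)))) ->
  tape_eq (ts out) (word_tape x [::]) ->
  exists s' ts' o, [/\ exec oracle O [:: divide] n.+1 (carry_of_int c) ts s' ts',
    tape_eq (ts' out) (word_tape (x ++ o) [::]),
    nat_of_bits o = X & (size o <= n)%N].
Proof.
elim/ltn_ind: n c A X ts y x => n IH c A X ts y x c_small sizeA X_lt pendingE ts_ans ts_out.
have read_ans t : reads ts (ans t) = head None (map Some (A t)).
  by rewrite /reads (tape_eq_read (ts_ans t)).
have blankE t : (reads ts (ans t) == None) = nilp (A t) by rewrite read_ans; case: (A t).
have [/andP[/eqP c0 /forallP blank] | go] :=
  boolP ((c == 0) && [forall t, reads ts (ans t) == None]).
  exists (carry_of_int c), ts, [::]; rewrite cats0 c0; split=> //.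
    by apply: (@exec_leq _ _ _ _ _ 1) => //; apply: exec_divide_stop => t; apply/eqP.
  rewrite pending_nil in pendingE; first by have := odd_gt0 odd_m; rewrite /=; nia.
  by move=> t; rewrite -blankE.
case: n => [|n] in IH sizeA X_lt *.
  have A0 t : nilp (A t) by rewrite /nilp -leqn0.
  case/negP: go; apply/andP; split; last by apply/forallP => t; rewrite blankE.
  by case: X X_lt pendingE => // _; rewrite pending_nil // muln0 => ->.
set v := digit_sum c (head false \o A).
pose moves := (fun i => (reads ts i, MoveRight)).[out <- (Some (odd `|v|), MoveRight)].
have [||||t||s' [ts' [o [ex ts'_out oE size_o]]]] :=
  IH n _ (next_carry v) (behead \o A) X./2 (act_all moves ts)
    (fun t => head None (map Some (A t)) :: y t) (rcons x (odd X))
    (norm_next_carry _ c_small).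
- by [].
- by move=> t; rewrite /= size_behead; have := sizeA t; lia.
- by move: X_lt; rewrite expnS; lia.
- exact: pending_next_carry.
- rewrite /act_all /moves updE (negbTE (ans_neq_out t)) read_ans /= -behead_map.
  exact: tape_eq_act (_, MoveRight) _ _ (ts_ans t).
- rewrite /act_all /moves updE eqxx /word_tape rev_rcons (odd_digit_sum pendingE).
  exact: tape_eq_act (Some (odd X), MoveRight) _ _ ts_out.
exists s', ts', (odd X :: o); split.
- by apply: exec_divide_again ex => // t; rewrite read_ans /=; case: (A t) => [|[]].
- by rewrite -cat_rcons.
- by rewrite /= oE odd_double_half.
- by [].
Qed.

End SerialDivision.

(** * The reduction *)

Section CombinationProgram.
Variables (T : finType) (l : T -> int) (K : T -> irreflexive_graph) (a m : nat).

Definition tape_name : finType := option (option (option T)).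
Definition input_name : tape_name := None.
Definition oracle_name : tape_name := Some None.
Definition output_name : tape_name := Some (Some None).
Definition answer_name (t : T) : tape_name := Some (Some (Some t)).

Definition combination_program : seq (instr tape_name (carry l m)) :=
  query_dunions oracle_name K input_name answer_name (enum T) ++
  [:: divide l m answer_name output_name] ++ drop_low_bits a output_name.

Variables (f g : irreflexive_graph -> nat) (O : seq bool -> seq bool) (n : nat).
Variable G : irreflexive_graph.
Hypotheses (odd_m : odd m) (oracleE : forall G', O (encode_graph G') = bits_of_nat (g G')).
Hypothesis combinationE :
  ((2 ^ a * m * f G)%N%:Z = \sum_t l t * (g (dunion G (K t)))%:Z)%R.
Hypotheses (size_G : size (encode_graph G) <= n)
  (size_dunion : forall t, size (encode_graph (dunion G (K t))) <= n)
  (g_lt : forall t, g (dunion G (K t)) < 2 ^ n) (f_lt : 2 ^ a * f G < 2 ^ n).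

Lemma runs_combination_program :
  exists s ts, runs oracle_name O n.+1 combination_program (carry_of_int l m 0)
    (fun i => if i == input_name then load (encode_graph G) else load [::]) s ts /\
  contents (ts output_name) = bits_of_nat (f G).
Proof.
set ts0 := fun i => if _ then _ else _.
have size_ans t : size (O (encode_graph (dunion G (K t)))) <= n.
  by rewrite oracleE; apply: size_bits_of_nat.
have ans_inj : injective answer_name by move=> t t' [].
have [ts1 [queries ts1_ans ts1_other]] :=
  @runs_query_dunions _ _ oracle_name O n.+1 T K answer_name (enum T) G input_name
    (carry_of_int l m 0) ts0 isT (fun=> isT) (fun=> isT) ans_inj (enum_uniq T) size_G
    size_dunion size_ans (tape_eq_refl _) (tape_eq_refl _) (fun _ _ => tape_eq_refl _).
pose answers t := bits_of_nat (g (dunion G (K t))).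
have pendingE : pending l 0 answers = (m * (2 ^ a * f G))%N.
  rewrite mulnCA mulnA combinationE /pending add0r.
  by apply: eq_bigr => t _; rewrite bits_of_natK natz.
have [|t|t||s2 [ts2 [o [division ts2_out oE size_o]]]] :=
  @exec_divide T l m odd_m _ answer_name output_name (fun=> isT) oracle_name O n 0
    answers _ ts1 (fun=> [::]) [::] _ _ f_lt pendingE.
- by rewrite normr0.
- exact: size_bits_of_nat.
- by rewrite ts1_ans ?mem_enum // oracleE.
- by rewrite ts1_other //; apply/mapP => -[].
have [u normalization] :=
  @runs_drop_low_bits _ _ oracle_name O n.+1 a output_name s2 ts2 o size_o ts2_out.
exists s2, ts2.[output_name <- word_tape u (bits_of_nat (nat_of_bits o %/ 2 ^ a))]; split.
  exact: runs_cat queries (runs_cat (runs1 (leqnn _) division) normalization).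
by rewrite updE eqxx contents_word_tape oE mulKn // expn_gt0.
Qed.

End CombinationProgram.

Definition graph_problem (f : irreflexive_graph -> nat) : counting_problem :=
  CountingProblem encode_graph f.

Definition exp_bounded (f : irreflexive_graph -> nat) : Prop :=
  exists c, forall G, f G < 2 ^ (c * size (encode_graph G)).

Lemma dunion_combination_reducible (f g : irreflexive_graph -> nat) (T : finType)
    (l : T -> int) (K : T -> irreflexive_graph) (d : nat) :
  exp_bounded f -> exp_bounded g -> 0 < d ->
  (forall G, (d * f G)%N%:Z = \sum_t l t * (g (dunion G (K t)))%:Z)%R ->
  poly_time_Turing_reducible (graph_problem f) (graph_problem g).
Proof.
move=> [cf f_lt] [cg g_lt] d_gt0 combinationE.
have [m /[!coprime2n] odd_m dE] := pfactor_coprime (isT : prime 2) d_gt0.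
set a := logn 2 d in dE; set E := \sum_t size (encode_graph (K t)).
pose C := 1 + E + cg * E + (a + cf); pose p := combination_program l K a m.
exists (program_machine (input_name T) (oracle_name T) (output_name T)
          p (carry_of_int l m 0)).
exists ((size p * C.+1)%:P * 'X)%R => O oracleE G; rewrite hornerM hornerC hornerX.
set N := size (encode _); have N_gt0 : 0 < N by rewrite /N /= size_encode_graph.
have size_dunion t : size (encode_graph (dunion G (K t))) <= N * E.
  apply: leq_trans (size_encode_dunion _ _) _.
  by rewrite leq_mul2l /E (bigD1 t) //= leq_addr orbT.
have [||t|t||s [ts [ex tsE]]] :=
  @runs_combination_program T l K a m f g O (C * N) G odd_m oracleE.
- by rewrite [2 ^ a * m]mulnC -dE.
- by rewrite -/N /C; nia.
- by apply: leq_trans (size_dunion t) _; rewrite /C; nia.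
- apply: leq_trans (g_lt _) _; rewrite leq_exp2l //.
  have := leq_mul (leqnn cg) (size_dunion t); rewrite /C; nia.
- have a2_gt0 : 0 < 2 ^ a by rewrite expn_gt0.
  apply: leq_trans (_ : 2 ^ a * 2 ^ (cf * N) <= _); first by rewrite ltn_mul2l a2_gt0 f_lt.
  by rewrite -expnD leq_exp2l // /C; nia.
apply: exec_outputs_within tsE; apply: exec_leq ex.
rewrite -[leqRHS]/(size p * C.+1 * N) -mulnA leq_mul2l; apply/orP; right; nia.
Qed.

Lemma num_hom_exp_bounded (H : graph) : exp_bounded (fun G => num_hom G H).
Proof.
exists #|H|.+1 => G; have num_hom_le : num_hom G H <= #|H| ^ graph_order G.
  by rewrite -[graph_order G]card_ord -card_ffun; apply: max_card.
have pow_le : #|H| ^ graph_order G <= 2 ^ (#|H| * graph_order G).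
  rewrite expnM; have [->|n_gt0] := posnP (graph_order G); first by rewrite !expn0.
  by rewrite leq_exp2r // ltnW // ltn_expl.
apply: leq_ltn_trans (leq_trans num_hom_le pow_le) _.
by rewrite ltn_exp2l // size_encode_graph; nia.
Qed.

Lemma num_compaction_exp_bounded (H : graph) : exp_bounded (fun G => num_compaction G H).
Proof.
have [c num_hom_lt] := num_hom_exp_bounded H; exists c => G.
apply: leq_ltn_trans (num_hom_lt G); apply: subset_leq_card.
by apply/subsetP => h; rewrite !inE => /and3P[].
Qed.

Theorem theorem3p4 (H : graph) :
  poly_time_Turing_reducible (count_hom H) (count_comp H).
Proof.
have [L [d [d_gt0 interpolation]]] := num_hom_interpolation (@gadget_detects_required H).
apply: (@dunion_combination_reducible _ _ 'I_(size L) (fun t => L`_t)%R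
          (copies (gadget H)) d _ _ d_gt0) => [||G].
- exact: num_hom_exp_bounded.
- exact: num_compaction_exp_bounded.
have := interpolation G; rewrite -natrM natz => ->.
by apply: eq_bigr => t _; rewrite natz.
Qed.
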